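(* The following exact values hold: $$f(4)=f'(4)=\frac47,\qquad f(5)=f'(5)=\frac5{11},\qquad f(6)=f'(6)=\frac{14}{37},\qquad f'(7)=\frac{17}{52},\qquad f'(8)=\frac27 .$$
   Context: All graphs are finite and simple. For an integer $\delta\ge 4$, $f(\delta)$ denotes the smallest rational number such that $\operatorname{diam}(G)\le f(\delta)\,n+O(1)$ for all connected graphs $G$ of order $n$, minimum degree $\delta$ and clique number $\omega(G)\le 3$, where the $O(1)$ term is bounded by a constant depending only on $\delta$. Similarly, $f'(\delta)$ denotes the smallest rational number such that $\operatorname{diam}(G)\le f'(\delta)\,n+O(1)$ for all connected graphs $G$ of order $n$, minimum degree $\delta$ and chromatic number $\chi(G)\le 3$, with the same convention on $O(1)$. *)

(* Defs.v *)
From HB Require Import structures.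
From mathcomp Require Import all_boot all_order all_algebra.

Set Implicit Arguments.
Unset Strict Implicit.
Unset Printing Implicit Defensive.

Import Order.TTheory GRing.Theory Num.Theory.

Record sgraph := SGraph {
  vertex :> finType;
  adj : rel vertex;
  adj_sym : symmetric adj;
  adj_irrefl : irreflexive adj }.

Section GraphParameters.
Variable G : sgraph.

Definition connected : bool :=
  (0 < #|G|) && [forall x : G, forall y : G, connect (@adj G) x y].

Definition degree (x : G) : nat := #|[set y | adj x y]|.

(* Every degree is smaller than #|G|, so the default value #|G| does not
   affect the minimum when G is nonempty. *)
Definition min_degree : nat := \big[minn/#|G|]_(x : G) degree x.

Definition walk (k : nat) (x y : G) : bool :=
  [exists p : k.-tuple G, path (@adj G) x p && (last x p == y)].

(* The length of a shortest walk from x to y. Such a walk has fewer than #|G|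
   edges; if there is none, the value is #|G|. *)
Definition dist (x y : G) : nat :=
  find (fun k => walk k x y) (iota 0 #|G|).

Definition diam : nat := \max_(x : G) \max_(y : G) dist x y.

Definition clique (A : {set G}) : bool :=
  [forall x in A, forall y in A, (x != y) ==> adj x y].

Definition clique_number : nat := \max_(A : {set G} | clique A) #|A|.

Definition colorable (k : nat) : bool :=
  [exists c : {ffun G -> 'I_k}, forall x, forall y, adj x y ==> (c x != c y)].

Lemma colorable_ex : exists k, colorable k.
Proof.
exists #|G|; apply/existsP; exists [ffun x => enum_rank x].
apply/forallP => x; apply/forallP => y; apply/implyP => xy.
rewrite !ffunE (inj_eq enum_rank_inj).
by apply: contraTneq xy => ->; rewrite adj_irrefl.
Qed.

Definition chromatic_number : nat := ex_minn colorable_ex.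

End GraphParameters.

Local Open Scope ring_scope.

(* diam(G) <= q n + O(1) over the connected graphs G in the class P with
   minimum degree d; C depends on d (and on P and q), but not on G. *)
Definition diam_bound (P : sgraph -> Prop) (d : nat) (q : rat) : Prop :=
  exists C : rat, forall G : sgraph,
    connected G -> min_degree G = d -> P G ->
    (diam G)%:R <= q * #|G|%:R + C.

Definition smallest_slope (P : sgraph -> Prop) (d : nat) (q : rat) : Prop :=
  diam_bound P d q /\ forall q' : rat, diam_bound P d q' -> q <= q'.

(* [f_is d q] is the assertion f(d) = q: it includes that the smallest
   rational defining f(d) exists. Likewise for [f'_is]. *)
Definition f_is : nat -> rat -> Prop :=
  smallest_slope (fun G => (clique_number G <= 3)%N).

Definition f'_is : nat -> rat -> Prop :=
  smallest_slope (fun G => (chromatic_number G <= 3)%N).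

(* Main.v *)
Require Import Defs.
From HB Require Import structures.
From mathcomp Require Import all_boot all_order all_algebra.
From Stdlib Require Import ZArith.
From mathcomp Require Import zify ssrZ ring lra.

(** Upper bounds. Cut a connected graph into its distance layers from an end of
    a diametral pair. If a K4-free graph has minimum degree d, a vertex of layer
    i is non-adjacent (itself included) to at most
      x_i = s_(i-1) + s_i + s_(i+1) - d
    vertices of the three layers around it, where s_i is the size of layer i.
    Choosing a clique greedily inside layers i and i+1, at most three picks
    exhaust both layers, which bounds s_i and s_i + s_(i+1) by combinations of
    x_i and x_(i+1). Among the sequences satisfying these local constraints, the
    smallest average size is a minimum mean cycle of a finite automaton; a
    feasible potential on its states certifies it. For d = 7 sizes alone only
    give the average 3, and the automaton reads the sizes of the colour classes
    of the layers of a 3-coloured graph instead.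

    Lower bounds. Take a periodic sequence of colour class sizes, join vertices
    of different colours in equal or consecutive layers, and make both end
    layers large enough to repair the degrees there. *)

Set Implicit Arguments.
Unset Strict Implicit.
Unset Printing Implicit Defensive.

Import Order.TTheory GRing.Theory Num.Theory.

(* ZArith has bound this key to its binary naturals. *)
Delimit Scope nat_scope with N.

(** * Potentials on a finite automaton *)

Section Potential.

Variables (T : eqType) (types : seq T) (adm : rel T) (ok : T -> T -> pred T).
Variables (D N : nat) (weight : T -> nat).

(** For [D > 0], a cycle has nonnegative total cost exactly when its mean weight is at least
    [N / D]. *)
Let cost c := (Z.of_nat D * Z.of_nat (weight c) - Z.of_nat N)%Z.

Fixpoint first_value (p : pred T) (l : seq (Z * T)) : Z :=
  if l is (z, c) :: l' then if p c then z else first_value p l' else 0%Z.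

Definition by_value (x y : Z * T) : bool := Z.leb x.1 y.1.

(* A state is a pair of consecutive types, reading c after (a, b) costs
   [cost c], and the table holds one value per state. One round of value
   iteration replaces a value by the least cost of continuing, capped at 0;
   sorting the continuations once for each b makes the rounds cheap. *)
Definition improve (tab : seq (seq Z)) : seq (seq Z) :=
  let successors :=
    [seq sort by_value
       [seq ((cost cv.1 + cv.2)%Z, cv.1) | cv <- zip types row] | row <- tab] in
  [seq [seq if adm a bl.1 then Z.min 0 (first_value (ok a bl.1) bl.2) else 0%Z
       | bl <- zip types successors] | a <- types].

Definition potential (k : nat) : seq (seq Z) :=
  ssrnat.iter k improve (nseq (size types) (nseq (size types) 0%Z)).

(** The inequality [tab <= improve tab] bounds each value by the cost of any allowed step plus the
    value reached, which excludes negative cycles. It is tested on the final table, so nothing has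
    to be proved about the convergence of value iteration. *)
Definition feasible_potential (tab : seq (seq Z)) : bool :=
  [&& size tab == size types, all (fun row => size row == size types) tab
    & all2 (all2 Z.leb) tab (improve tab)].

Let value (tab : seq (seq Z)) (a b : T) : Z :=
  nth 0%Z (nth [::] tab (index a types)) (index b types).

Lemma first_value_le (p : pred T) (l : seq (Z * T)) (z : Z) (c : T) :
  sorted by_value l -> (z, c) \in l -> p c -> (first_value p l <= z)%Z.
Proof.
have by_value_trans : transitive by_value by move=> x y u; rewrite /by_value; lia.
elim: l => [//|[z' c'] l IHl] /= pl; rewrite inE => /orP[/eqP[-> ->] ->|zc_l pc].
  lia.
have /allP/(_ _ zc_l) := order_path_min by_value_trans pl.
case: ifP => _; first by rewrite /by_value /=; lia.
by move=> _; apply: IHl => //; apply: path_sorted pl.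
Qed.

Lemma improve_le (tab : seq (seq Z)) (a b c : T) :
  size tab = size types -> all (fun row => size row == size types) tab ->
  a \in types -> b \in types -> c \in types -> adm a b -> ok a b c ->
  (value (improve tab) a b <= cost c + value tab b c)%Z.
Proof.
move=> sz_tab /allP sz_row aT bT cT adm_ab ok_abc; rewrite /value /improve.
rewrite (nth_map a) ?index_mem // nth_index //.
set l := (X in zip types X).
have sz_l : size l = size types by rewrite size_map.
rewrite (nth_map (b, [::])) ?size_zip ?sz_l ?minnn ?index_mem //.
rewrite nth_zip ?sz_l //= nth_index // adm_ab.
apply: Z.le_trans (Z.le_min_r _ _) _.
rewrite (nth_map [::]) ?sz_tab ?index_mem //.
have /eqP sz_b : size (nth [::] tab (index b types)) == size types.
  by apply: sz_row; rewrite mem_nth // sz_tab index_mem.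
apply: first_value_le ok_abc.
  by apply: sort_sorted => x y; rewrite /by_value; lia.
rewrite mem_sort; apply/(nthP (0%Z, c)); exists (index c types).
  by rewrite size_map size_zip sz_b minnn index_mem.
rewrite (nth_map (c, 0%Z)) ?size_zip ?sz_b ?minnn ?index_mem //.
by rewrite nth_zip ?sz_b //= nth_index.
Qed.

Lemma improve_le0 (tab : seq (seq Z)) (a b : T) :
  size tab = size types -> a \in types -> b \in types ->
  (value (improve tab) a b <= 0)%Z.
Proof.
move=> sz_tab aT bT; rewrite /value (nth_map a) ?index_mem // nth_index //.
rewrite (nth_map (b, [::])) ?size_zip ?size_map ?sz_tab ?minnn ?index_mem //.
case: ifP => _; lia.
Qed.

Lemma feasible_potential_value (tab : seq (seq Z)) (a b : T) :
  feasible_potential tab -> a \in types -> b \in types ->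
  (value tab a b <= value (improve tab) a b)%Z.
Proof.
case/and3P=> /eqP sz_tab /allP sz_row.
rewrite all2E => /andP[_ /all_nthP-/(_ ([::], [::])) le_rows] aT bT.
have sz_imp : size tab = size (improve tab) by rewrite size_map.
have lt_a : index a types < size (zip tab (improve tab)).
  by rewrite size_zip -sz_imp sz_tab minnn index_mem.
have := le_rows _ lt_a; rewrite nth_zip //= all2E => /andP[/eqP sz_eq].
have /eqP sz_a : size (nth [::] tab (index a types)) == size types.
  by apply: sz_row; rewrite mem_nth // sz_tab index_mem.
move=> /all_nthP-/(_ (0%Z, 0%Z) (index b types)).
by rewrite size_zip -sz_eq sz_a minnn index_mem nth_zip //= /value => /(_ bT); lia.
Qed.

Lemma value_bounded_below (tab : seq (seq Z)) :
  exists K : nat, forall a b, (- Z.of_nat K <= value tab a b)%Z.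
Proof.
have row_bound (row : seq Z) :
    exists K : nat, forall i, (- Z.of_nat K <= nth 0%Z row i)%Z.
  elim: row => [|z row [K leK]]; first by exists 0 => i; rewrite nth_nil.
  exists (maxn K (Z.abs_nat z)) => -[|i] /=; first by lia.
  by have := leK i; lia.
suff [K leK] : exists K : nat, forall i j, (- Z.of_nat K <= nth 0%Z (nth [::] tab i) j)%Z.
  by exists K => a b; apply: leK.
elim: tab => [|row tab [K leK]]; first by exists 0 => i j; rewrite !nth_nil.
have [K' leK'] := row_bound row.
exists (maxn K K') => -[|i] j /=; first by have := leK' j; lia.
by have := leK i j; lia.
Qed.

Lemma potential_bound (tab : seq (seq Z)) :
  feasible_potential tab ->
  exists K : nat, forall (s : nat -> T) (m : nat),
    (forall i, i <= m.+1 -> s i \in types) ->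
    (forall i, i < m -> adm (s i) (s i.+1) && ok (s i) (s i.+1) (s i.+2)) ->
    N * m <= D * (\sum_(i < m) weight (s i.+2)) + K.
Proof.
move=> tab_ok; have [K leK] := value_bounded_below tab; exists K => s m sT s_ok.
have [/eqP sz_tab sz_row _] := and3P tab_ok.
pose phi i := value tab (s i) (s i.+1).
(* The step inequalities telescope. Afterwards [phi m <= 0] by the cap and [phi 0 >= - K], so the
   error does not depend on [m]. *)
have sum_le n : n <= m -> (phi 0%N + Z.of_nat (N * n)%N <=
    Z.of_nat (D * \sum_(i < n) weight (s i.+2))%N + phi n)%Z.
  elim: n => [_|n IHn lt_nm]; first by rewrite big_ord0; lia.
  rewrite big_ord_recr /= mulnDr mulnS.
  have /andP[adm_n ok_n] := s_ok n lt_nm.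
  have [sn sn1 sn2] : [/\ s n \in types, s n.+1 \in types & s n.+2 \in types].
    by split; apply: sT; lia.
  have := feasible_potential_value tab_ok sn sn1.
  have := improve_le sz_tab sz_row sn sn1 sn2 adm_n ok_n.
  rewrite -/(phi n) -/(phi n.+1) /cost.
  by have := IHn (ltnW lt_nm); move: (\sum_(i < n) _) (value (improve _) _ _); lia.
have := sum_le m (leqnn m); have := leK (s 0) (s 1).
have [sm sm1] : s m \in types /\ s m.+1 \in types by split; apply: sT; lia.
have := feasible_potential_value tab_ok sm sm1.
have := improve_le0 sz_tab sm sm1.
rewrite -/(phi m) -/(phi 0). lia.
Qed.

End Potential.

(** * Distance layers *)

Section Distance.

Variable G : sgraph.
Implicit Types (x y u v : G) (k : nat).

Lemma walkP k x y :
  reflect (exists p : seq G, [/\ size p = k, path (@adj G) x p & last x p = y])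
          (walk k x y).
Proof.
apply: (iffP existsP) => [[p /andP[xp /eqP <-]]|[p [sz_p xp <-]]].
  by exists p; rewrite size_tuple.
have sz : size p == k by apply/eqP.
by exists (Tuple sz); rewrite /= xp eqxx.
Qed.

Lemma dist_le k x y : walk k x y -> dist x y <= k.
Proof.
move=> w; rewrite leqNgt; apply/negP => lt_k.
have lt_kG : k < #|G|.
  by apply: leq_trans lt_k _; rewrite -[leqRHS](size_iota 0) find_size.
by have := before_find 0 lt_k; rewrite nth_iota // add0n w.
Qed.

Lemma dist_walk x y : connected G -> walk (dist x y) x y.
Proof.
case/andP=> _ /forallP/(_ x)/forallP/(_ y)/connectP[p xp ->].
(* A path without repetitions has fewer than [#|G|] edges, so the search in [dist] succeeds and does
   not return its default. *)
case/shortenP: xp => p' xp' uniq_p' _.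
have lt_p' : size p' < #|G| by rewrite -[(size p').+1]/(size (x :: p')) -(card_uniqP uniq_p') max_card.
have has_w : has (fun k => walk k x (last x p')) (iota 0 #|G|).
  apply/hasP; exists (size p'); first by rewrite mem_iota.
  by apply/walkP; exists p'.
have := nth_find 0 has_w; rewrite nth_iota //.
by move: has_w; rewrite has_find size_iota.
Qed.

Lemma dist_walk_le k x u v :
  connected G -> walk k u v -> dist x v <= dist x u + k.
Proof.
move=> conG /walkP[q [<- uq lq]].
have /walkP[p [sz_p xp lp]] := dist_walk x u conG.
apply: dist_le; apply/walkP; exists (p ++ q).
by rewrite size_cat sz_p cat_path last_cat xp lp uq lq.
Qed.

Lemma dist_adj x u v : connected G -> adj u v -> dist x v <= (dist x u).+1.
Proof.
move=> conG uv; rewrite -addn1; apply: dist_walk_le => //.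
by apply/walkP; exists [:: v]; rewrite /= uv.
Qed.

(** The vertex after [i] steps of a shortest walk is at distance exactly [i], since otherwise the
    walk could be shortened. *)
Lemma dist_level x y i :
  connected G -> i <= dist x y -> exists v, dist x v = i.
Proof.
move=> conG le_i; have /walkP[p [sz_p]] := dist_walk x y conG.
have sz_drop := size_drop i p.
have sz_take : size (take i p) = i by rewrite size_takel ?sz_p.
rewrite -{1 2}(cat_take_drop i p) cat_path last_cat => /andP[xv vy] ly.
exists (last x (take i p)).
have le_v : dist x (last x (take i p)) <= i.
  by apply: dist_le; apply/walkP; exists (take i p).
have : dist x y <= dist x (last x (take i p)) + size (drop i p).
  by apply: dist_walk_le => //; apply/walkP; exists (drop i p).
lia.
Qed.

(** Along a walk, [l] grows by at most one per edge. Applied to layer indices, this bounds diameters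
    from below. *)
Lemma dist_ge (l : G -> nat) x y :
  (forall u v, adj u v -> l v <= (l u).+1) -> connected G -> l y <= l x + dist x y.
Proof.
move=> l_adj conG; have /walkP[p [<- xp <-]] := dist_walk x y conG.
elim: p x xp => [|v p IHp] x /=; first by lia.
by case/andP=> /l_adj le_v /IHp; lia.
Qed.

Lemma diam_attained : connected G -> exists x y, diam G = dist x y.
Proof.
case/andP=> G_gt0 _; have [x Dx] := bigop.eq_bigmax (fun x : G => \max_(y : G) dist x y) G_gt0.
have [y Dy] := bigop.eq_bigmax (fun y : G => dist x y) G_gt0.
by exists x, y; rewrite /diam Dx Dy.
Qed.

Lemma dist_le_diam x y : dist x y <= diam G.
Proof. exact: leq_trans (bigop.leq_bigmax y) (bigop.leq_bigmax x). Qed.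

End Distance.

(** * Minimum degree, cliques and colourings *)

Lemma min_degree_le (G : sgraph) (x : G) : min_degree G <= degree x.
Proof.
rewrite /min_degree; elim: (index_enum G) (mem_index_enum x) => [//|y s IHs].
rewrite inE big_cons geq_min => /orP[/eqP->|/IHs ->]; first by rewrite leqnn.
exact: orbT.
Qed.

Lemma card_clique_le (G : sgraph) (A : {set G}) : clique A -> #|A| <= clique_number G.
Proof. exact: bigop.leq_bigmax_cond. Qed.

(** A proper colouring is injective on a clique. *)
Lemma colorable_clique_number (G : sgraph) (k : nat) : colorable G k -> clique_number G <= k.
Proof.
case/existsP=> c /forallP c_proper; apply/bigop.bigmax_leqP => A /forall_inP A_clique.
rewrite -[k]card_ord -(card_in_imset (f := c)) ?max_card // => x y xA yA cxy.
apply: contra_eq cxy => neq_xy.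
have /forall_inP/(_ y yA)/implyP/(_ neq_xy) xy := A_clique x xA.
by have /forallP/(_ y)/implyP/(_ xy) := c_proper x.
Qed.

(* Greedy choice of a clique: after picking v, only the neighbours of v remain,
   so v accounts for the vertices it is not adjacent to. Vertices of A are
   picked as long as there are any. *)
Lemma greedy_clique (G : sgraph) (r x y : nat) (A B : {set G}) :
  (forall K : {set G}, clique K -> K \subset A :|: B -> #|K| <= r) ->
  (forall v, v \in A -> #|[set u in A :|: B | ~~ adj v u]| <= x) ->
  (forall v, v \in B -> #|[set u in A :|: B | ~~ adj v u]| <= y) ->
  exists t, [/\ t <= r, t <= #|A|, #|A| <= t * x & #|A :|: B| <= t * x + (r - t) * y].
Proof.
elim: r A B => [|r IHr] A B small_clique xA yB.
  have AB0 : A :|: B = set0.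
    apply/setP => v; rewrite [RHS]inE; apply/negbTE/negP => vAB.
    suff : #|[set v]| <= 0 by rewrite cards1.
    apply: small_clique; last by rewrite sub1set.
    apply/forall_inP => a /set1P->; apply/forall_inP => b /set1P->.
    by rewrite eqxx.
  have A0 : A = set0 by apply/eqP; rewrite -subset0 -AB0 subsetUl.
  by exists 0; rewrite AB0 A0 cards0.
(* Picking [v] restricts both sets to its neighbours. A clique found there is extended by [v], so
   its size is at most [r]. *)
have shrink v : v \in A :|: B ->
    let A' := A :&: [set u | adj v u] in let B' := B :&: [set u | adj v u] in
    exists t, [/\ t <= r, t <= #|A'|, #|A'| <= t * x
                & #|A' :|: B'| <= t * x + (r - t) * y].
  move=> vAB A' B'.
  have subAB : A' :|: B' \subset A :|: B by rewrite setUSS ?subsetIl.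
  have le_card u : #|[set w in A' :|: B' | ~~ adj u w]| <= #|[set w in A :|: B | ~~ adj u w]|.
    apply: subset_leq_card; apply/subsetP => w; rewrite !inE.
    by case/andP=> /orP[]/andP[-> _] ->; rewrite ?orbT.
  apply: IHr => [K K_clique subK|u|u].
  - have adjK u : u \in K -> adj v u.
      by move/(subsetP subK); rewrite !inE => /orP[]/andP[].
    have vK : v \notin K by apply/negP => /adjK; rewrite adj_irrefl.
    suff : #|v |: K| <= r.+1 by rewrite cardsU1 vK.
    apply: small_clique; last first.
      by rewrite subUset sub1set vAB (subset_trans subK).
    apply/forall_inP => a /setU1P a_vK; apply/forall_inP => b /setU1P b_vK.
    apply/implyP; case: a_vK b_vK => [->|aK] [->|bK]; first by rewrite eqxx.
    + by move=> _; apply: adjK.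
    + by move=> _; rewrite adj_sym; apply: adjK.
    + by have /forall_inP/(_ a aK)/forall_inP/(_ b bK)/implyP := K_clique.
  - by case/setIP=> uA _; apply: leq_trans (le_card u) (xA u uA).
  - by case/setIP=> uB _; apply: leq_trans (le_card u) (yB u uB).
have card_split v (S : {set G}) : #|S| = #|S :&: [set u | adj v u]| + #|[set u in S | ~~ adj v u]|.
  rewrite -(cardsID [set u | adj v u] S); congr (_ + #|pred_of_set _|).
  by apply/setP => u; rewrite !inE andbC.
have [A0|[v vA]] := set_0Vmem A.
  have [B0|[v vB]] := set_0Vmem B.
    by exists 0; rewrite A0 B0 setU0 cards0.
  (* With [A] empty the pick is made in [B], and [t <= #|A'|] forces [t = 0]: all picks are charged
     to [y]. *)
  have [|t [le_tr le_tA _ le_AB]] := shrink v; first by rewrite inE vB orbT.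
  move: le_tA le_AB; rewrite A0 set0I cards0 leqn0 => /eqP-> le_AB.
  exists 0; split=> //; move: (yB v vB) le_AB; rewrite A0 !set0U (card_split v B).
  by lia.
have vAB : v \in A :|: B by rewrite inE vA.
(* A pick in [A] raises [t] by one. As [v] is not adjacent to itself, it leaves [A], which keeps
   [t <= #|A|]. *)
have [t [le_tr le_tA le_A le_AB]] := shrink v vAB.
have := xA v vA; rewrite (card_split v (A :|: B)) setIUl.
have := card_split v A.
have : #|[set u in A | ~~ adj v u]| <= #|[set u in A :|: B | ~~ adj v u]|.
  by apply: subset_leq_card; apply/subsetP => u; rewrite !inE => /andP[-> ->].
have : 0 < #|[set u in A | ~~ adj v u]|.
  by apply/card_gt0P; exists v; rewrite inE vA adj_irrefl.
by exists t.+1; rewrite subSS mulSn; split; lia.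
Qed.

(** * The automaton of layer sizes *)

(** The numerical conclusion of [greedy_clique] for [r = 3] and disjoint sets of sizes [a] and
    [b]. *)
Definition coverable (a b x y : nat) : bool :=
  has (fun t => (a <= t * x) && (a + b <= t * x + (3 - t) * y)) (iota 0 (minn 3 a).+1).

(* Types are pairs of consecutive layer sizes. The size M stands for all sizes
   >= M, and imposes no constraint. *)
Definition size_types (M : nat) : seq (nat * nat) :=
  [seq (a, b) | a <- iota 1 M, b <- iota 1 M].

Definition size_adm : rel (nat * nat) := fun u v => u.2 == v.1.

(** Three overlapping pairs describe four consecutive layers. The two inner ones are tested in both
    orders of greedy choice. *)
Definition size_ok (d M : nat) (u v w : nat * nat) : bool :=
  (v.2 == w.1) &&
  let x := u.1 + v.1 + v.2 - d in
  let y := v.1 + v.2 + w.2 - d in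
  [|| u.1 == M, v.1 == M, v.2 == M, w.2 == M |
    coverable v.1 v.2 x y && coverable v.2 v.1 y x].

(* [k] is a number of rounds after which value iteration is stationary. *)
Definition size_check (d M D N k : nat) : bool :=
  feasible_potential (size_types M) size_adm (size_ok d M) D N snd
    (potential (size_types M) size_adm (size_ok d M) D N snd k).

Section Levels.

Variables (G : sgraph) (l : G -> nat).
Hypothesis l_adj : forall u v, adj u v -> l v <= (l u).+1.

Definition level i := [set v | l v == i].

Lemma neighbours_levels i v :
  l v = i.+1 -> [set u | adj v u] \subset level i :|: level i.+1 :|: level i.+2.
Proof.
move=> lv; apply/subsetP => u; rewrite !inE => vu.
by have := l_adj vu; rewrite adj_sym in vu; have := l_adj vu; lia.
Qed.

Lemma card_non_neighbours i v : l v = i.+1 ->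
  #|[set u in level i :|: level i.+1 :|: level i.+2 | ~~ adj v u]| + degree v
    <= #|level i| + #|level i.+1| + #|level i.+2|.
Proof.
move=> lv; set W := level i :|: _ :|: _.
have -> : [set u in W | ~~ adj v u] = W :\: [set u | adj v u].
  by apply/setP => u; rewrite !inE andbC.
have := cardsID [set u | adj v u] W; rewrite (setIidPr (neighbours_levels lv)) -/(degree v).
have := leq_card_setU (level i :|: level i.+1) (level i.+2).
have := leq_card_setU (level i) (level i.+1).
by rewrite -/W => -[+ _] [+ _]; lia.
Qed.

Lemma sum_level_le m k : \sum_(i < m) #|level (i + k)| <= #|G|.
Proof.
suff: \sum_(i < m) #|level (i + k)| <= #|[set v | l v < m + k]|.
  by move/leq_trans; apply; apply: max_card.
elim: m => [|m IHm]; first by rewrite big_ord0.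
rewrite big_ord_recr /=; apply: leq_trans (leq_add IHm (leqnn _)) _.
rewrite -cardsUI [X in _ + #|pred_of_set X|](_ : _ = set0) ?cards0 ?addn0.
  by apply: subset_leq_card; apply/subsetP => v; rewrite !inE; lia.
by apply/setP => v; rewrite !inE; lia.
Qed.

Lemma level_coverable d i : min_degree G = d -> clique_number G <= 3 ->
  let s k := #|level (i + k)| in
  let x := s 0 + s 1 + s 2 - d in
  let y := s 1 + s 2 + s 3 - d in
  coverable (s 1) (s 2) x y /\ coverable (s 2) (s 1) y x.
Proof.
rewrite /= addn0 addn1 addn2 addn3 => deg_G K4free.
set x := #|level i| + _ + _ - d; set y := #|level i.+1| + _ + _ - d.
have card_AB : #|level i.+1 :|: level i.+2| = #|level i.+1| + #|level i.+2|.
  rewrite -cardsUI [X in _ = _ + #|pred_of_set X|](_ : _ = set0) ?cards0 ?addn0 //.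
  by apply/setP => v; rewrite !inE; lia.
have small (K : {set G}) : clique K -> #|K| <= 3.
  by move/card_clique_le => le_K; apply: leq_trans le_K K4free.
have x_bound v : v \in level i.+1 ->
    #|[set u in level i.+1 :|: level i.+2 | ~~ adj v u]| <= x.
  rewrite inE => /eqP lv; have := card_non_neighbours lv.
  have := min_degree_le v; rewrite deg_G /x.
  have : #|[set u in level i.+1 :|: level i.+2 | ~~ adj v u]| <=
      #|[set u in level i :|: level i.+1 :|: level i.+2 | ~~ adj v u]|.
    apply: subset_leq_card; apply/subsetP => u; rewrite !inE.
    by case/andP=> /orP[] -> ->; rewrite ?orbT.
  by lia.
have y_bound v : v \in level i.+2 ->
    #|[set u in level i.+1 :|: level i.+2 | ~~ adj v u]| <= y.
  rewrite inE => /eqP lv; have := card_non_neighbours lv.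
  have := min_degree_le v; rewrite deg_G /y.
  have : #|[set u in level i.+1 :|: level i.+2 | ~~ adj v u]| <=
      #|[set u in level i.+1 :|: level i.+2 :|: level i.+3 | ~~ adj v u]|.
    apply: subset_leq_card; apply/subsetP => u; rewrite !inE.
    by case/andP=> /orP[] -> ->; rewrite ?orbT.
  by lia.
split; apply/hasP.
  have [t [le_t3 le_tA le_A le_AB]] :=
    greedy_clique (fun K cK _ => small K cK) x_bound y_bound.
  by exists t; rewrite ?mem_iota ?le_A -?card_AB //; lia.
(* The second condition comes from starting the greedy choice in layer [i.+2]. *)
rewrite setUC in x_bound y_bound card_AB.
have [t [le_t3 le_tA le_A le_AB]] :=
  greedy_clique (fun K cK _ => small K cK) y_bound x_bound.
by exists t; rewrite ?mem_iota ?le_A // addnC -?card_AB //; lia.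
Qed.

End Levels.

Lemma mem_size_types M a b : ((a, b) \in size_types M) = (0 < a <= M) && (0 < b <= M).
Proof.
apply/allpairsP/idP => [[[a' b'] /= []]|ab].
  by rewrite !mem_iota => ? ? [-> ->]; lia.
by exists (a, b); rewrite /= !mem_iota; split=> //; lia.
Qed.

Lemma level_pos (G : sgraph) (x y : G) i :
  connected G -> i <= dist x y -> 0 < #|level (dist x) i|.
Proof.
move=> conG le_i; have [v Dv] := dist_level conG le_i.
by apply/card_gt0P; exists v; rewrite inE Dv.
Qed.

Lemma K4free_diam_bound d M D N k : 0 < M -> size_check d M D N k ->
  exists K, forall G : sgraph, connected G -> min_degree G = d ->
    clique_number G <= 3 -> N * diam G <= D * #|G| + K.
Proof.
move=> M_gt0 /potential_bound[K leK]; exists (K + 2 * N) => G conG deg_G K4free.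
have [x [y ->]] := diam_attained conG.
(* The summand [2 * N] pays for diameters below 2 and, below, for the two steps not read by the
   automaton. *)
have [lt2|le2] := ltnP (dist x y) 2; first by nia.
pose s i := #|level (dist x) i|; pose c i := minn (s i) M.
have s_gt0 i : i <= dist x y -> 0 < s i by apply: level_pos.
have l_adj u v : adj u v -> dist x v <= (dist x u).+1 by apply: dist_adj.
(* A run of [m] steps visits layers up to [m + 2], so [m = dist x y - 2] keeps all of them
   nonempty. *)
have := leK (fun i => (c i, c i.+1)) (dist x y - 2).
have sum_c : \sum_(i < dist x y - 2) c i.+3 <= #|G|.
  apply: leq_trans (sum_level_le (dist x) (dist x y - 2) 3).
  by apply: leq_sum => i _; rewrite /c /s addn3 geq_minl.
move/(_ _ _)/leq_trans => bound.
suff: N * (dist x y - 2) <= D * #|G| + K by nia.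
apply: bound.
- move=> i le_i; rewrite mem_size_types /c.
  by have := s_gt0 i; have := s_gt0 i.+1; lia.
- move=> i lt_i; rewrite /size_adm /size_ok /= !eqxx /=.
  have := level_coverable l_adj i deg_G K4free.
  rewrite /= addn0 addn1 addn2 addn3 -/(s i) -/(s i.+1) -/(s i.+2) -/(s i.+3).
  (* Either one of the four entries is [M] and the constraint is void, or all four are true layer
     sizes. *)
  have cE j : (c j == M) || (c j == s j) by rewrite /c; lia.
  have := cE i; have := cE i.+1; have := cE i.+2; have := cE i.+3.
  do 4!(case/orP=> [->|/eqP->]; rewrite ?orbT //).
  by case=> -> ->; rewrite !orbT.
- by rewrite leq_add2r leq_mul2l sum_c orbT.
Qed.

(** * The automaton of colour class sizes *)

Definition triple := (nat * nat * nat)%type.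

Definition layer_size (t : triple) : nat := t.1.1 + t.1.2 + t.2.

(** Component [k] is the largest number of neighbours that a layer can offer to a vertex of colour
    [k]. *)
Definition others (t : triple) : triple := (t.1.2 + t.2, t.1.1 + t.2, t.1.1 + t.1.2).

Definition need (d a b c : nat) : nat := if b is 0 then 0 else d - a - c.

(* Every colour present in the middle layer b sees at least d vertices of the
   other colours; the requirements on the last layer are computed before it is
   read. *)
Definition color_ok (d : nat) (a b : triple) : pred triple :=
  let oa := others a in let ob := others b in
  let n1 := need d oa.1.1 b.1.1 ob.1.1 in
  let n2 := need d oa.1.2 b.1.2 ob.1.2 in
  let n3 := need d oa.2 b.2 ob.2 in
  fun c => [&& n1 <= c.1.2 + c.2, n2 <= c.1.1 + c.2 & n3 <= c.1.1 + c.1.2].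

(* The first type stands for all layers with more than M vertices. *)
Definition color_types (M : nat) : seq triple :=
  (M.+1, M.+1, M.+1) ::
  [seq t <- [seq (ab, c) | ab <- [seq (a, b) | a <- iota 0 M.+1, b <- iota 0 M.+1],
                           c <- iota 0 M.+1] | 0 < layer_size t <= M].

(** The type for large layers has 3(M+1) vertices but may represent a layer with only M+1, so it
    must be charged no more than that. *)
Definition capped_size (M : nat) (t : triple) : nat := minn (layer_size t) M.+1.

Definition color_check (d M D N k : nat) : bool :=
  feasible_potential (color_types M) (fun _ _ => true) (color_ok d) D N (capped_size M)
    (potential (color_types M) (fun _ _ => true) (color_ok d) D N (capped_size M) k).

Section ColorLevels.

Variables (G : sgraph) (l : G -> nat) (c : G -> 'I_3).
Hypothesis l_adj : forall u v, adj u v -> l v <= (l u).+1.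
Hypothesis c_proper : forall u v, adj u v -> c u != c v.

Definition color_count i k := #|[set v | (l v == i) && (c v == k :> nat)]|.

Definition level_type i : triple := (color_count i 0, color_count i 1, color_count i 2).

Definition other_count i (k : 'I_3) := #|[set v | (l v == i) && (c v != k)]|.

Lemma card_other_colors i (k : 'I_3) :
  other_count i k + color_count i k = #|level l i|.
Proof.
rewrite addnC /color_count -(cardsID [set v | c v == k] (level l i)).
by congr (_ + _); apply: eq_card => v; rewrite !inE // andbC.
Qed.

Lemma card_level_colors i : #|level l i| = layer_size (level_type i).
Proof.
rewrite /layer_size /= /color_count -(cardsID [set v | c v == 0 :> nat] (level l i)) -addnA.
congr (_ + _); first by apply: eq_card => v; rewrite !inE.
rewrite -(cardsID [set v | c v == 1 :> nat]).
congr (_ + _); apply: eq_card => v; rewrite !inE;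
  by case: (c v) => -[|[|[|]]] //= ?; rewrite ?andbF ?andbT.
Qed.

Lemma degree_other_colors i v : l v = i.+1 ->
  degree v <= other_count i (c v) + other_count i.+1 (c v) + other_count i.+2 (c v).
Proof.
move=> lv; have sub : [set u | adj v u] \subset
   [set u | (l u == i) && (c u != c v)] :|: [set u | (l u == i.+1) && (c u != c v)]
     :|: [set u | (l u == i.+2) && (c u != c v)].
  apply/subsetP => u vu; have := subsetP (neighbours_levels l_adj lv) u vu.
  by move: vu; rewrite !inE => /c_proper; rewrite eq_sym => ->; rewrite !andbT.
apply: leq_trans (subset_leq_card sub) _.
apply: leq_trans (leq_card_setU _ _) _.
by rewrite leq_add2r leq_card_setU.
Qed.

Lemma level_types_ok d i : min_degree G = d ->
  color_ok d (level_type i) (level_type i.+1) (level_type i.+2).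
Proof.
move=> deg_G.
have color_deg (k : 'I_3) : 0 < color_count i.+1 k ->
    d + color_count i k + color_count i.+1 k + color_count i.+2 k
      <= layer_size (level_type i) + layer_size (level_type i.+1) + layer_size (level_type i.+2).
  case/card_gt0P=> v; rewrite inE => /andP[/eqP lv /eqP/val_inj cv].
  have := degree_other_colors lv; have := min_degree_le v; rewrite deg_G cv /=.
  rewrite -!card_level_colors -!(card_other_colors _ k); lia.
have := color_deg (@Ordinal 3 0 isT); have := color_deg (@Ordinal 3 1 isT).
have := color_deg (@Ordinal 3 2 isT).
rewrite /color_ok /need /layer_size /=.
case: (color_count i.+1 0) => [|a]; case: (color_count i.+1 1) => [|b];
  case: (color_count i.+1 2) => [|e]; lia.
Qed.

End ColorLevels.

Definition cap (M : nat) (t : triple) : triple :=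
  if layer_size t <= M then t else (M.+1, M.+1, M.+1).

(** The replacement type offers 2(M+1) >= d vertices of other colours to every colour, so it meets
    all demands wherever it stands in the window. *)
Lemma cap_color_ok d M a b c : d <= M.+1 ->
  color_ok d a b c -> color_ok d (cap M a) (cap M b) (cap M c).
Proof.
move=> le_d; rewrite /cap.
case: (leqP (layer_size a) M) => ?; case: (leqP (layer_size b) M) => ?;
  case: (leqP (layer_size c) M) => ? //= _; rewrite /color_ok /need /=;
  case: b.1.1 => [|?]; case: b.1.2 => [|?]; case: b.2 => [|?]; lia.
Qed.

Lemma cap_types M t : 0 < layer_size t -> cap M t \in color_types M.
Proof.
move=> t_gt0; rewrite /cap; case: leqP => le_t; rewrite inE; last by rewrite eqxx.
apply/orP; right; rewrite mem_filter t_gt0 le_t !andTb.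
case: t t_gt0 le_t => -[a b] c _; rewrite {1}/layer_size => le_t.
apply/allpairsP; exists ((a, b), c); split=> //; last by rewrite mem_iota; move: le_t => /=; lia.
apply/allpairsP; exists (a, b); rewrite !mem_iota; split=> //; by move: le_t => /=; lia.
Qed.

Lemma color_diam_bound d M D N k : d <= M.+1 -> color_check d M D N k ->
  exists K, forall G : sgraph, connected G -> min_degree G = d ->
    chromatic_number G <= 3 -> N * diam G <= D * #|G| + K.
Proof.
move=> le_d /potential_bound[K leK]; exists (K + 2 * N) => G conG deg_G chi3.
have /existsP[c0 /forallP c0_proper] : colorable G (chromatic_number G).
  by rewrite /chromatic_number; case: ex_minnP.
pose c v := widen_ord chi3 (c0 v).
have c_proper u v : adj u v -> c u != c v.
  by have /forallP/(_ v)/implyP := c0_proper u.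
have [x [y ->]] := diam_attained conG.
have l_adj u v : adj u v -> dist x v <= (dist x u).+1 by apply: dist_adj.
have [lt2|le2] := ltnP (dist x y) 2; first by nia.
pose s := level_type (dist x) c.
have sE i : layer_size (s i) = #|level (dist x) i| by rewrite (card_level_colors (dist x) c).
have s_gt0 i : i <= dist x y -> 0 < layer_size (s i) by rewrite sE; apply: level_pos.
suff: N * (dist x y - 2) <= D * #|G| + K by nia.
apply: leq_trans (leK (fun i => cap M (s i)) (dist x y - 2) _ _) _.
- by move=> i le_i; apply/cap_types/s_gt0; lia.
- by move=> i lt_i; apply: cap_color_ok => //; apply: level_types_ok.
(* Capping never charges a layer more than its true size. *)
- rewrite leq_add2r leq_mul2l; apply/orP; right.
  apply: leq_trans (sum_level_le (dist x) (dist x y - 2) 2).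
  apply: leq_sum => i _; rewrite addn2 -sE /cap.
  case: ifPn => [_|]; first exact: geq_minl.
  by rewrite -ltnNge; apply: leq_trans (geq_minr _ _).
Qed.

(** * Periodic graphs *)

Definition entry (t : triple) (k : nat) : nat := nth 0 [:: t.1.1; t.1.2; t.2] k.

Definition pattern_at (pat : seq triple) (i : nat) : triple :=
  nth (0, 0, 0) pat (i %% size pat).

(** Guarantees an edge between consecutive layers, for connectivity. *)
Definition linked (a b : triple) : bool :=
  has (fun k => has (fun k' => [&& k != k', 0 < entry a k & 0 < entry b k'])
                    (iota 0 3)) (iota 0 3).

Definition other_total (a b c : triple) (k : nat) : nat :=
  entry (others a) k + entry (others b) k + entry (others c) k.

(** Provides a vertex of degree exactly [d], so that the minimum degree is not larger. *)
Definition tight d (a b c : triple) : bool :=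
  has (fun k => (0 < entry b k) && (other_total a b c k == d)) (iota 0 3).

Definition pattern_ok (d : nat) (pat : seq triple) : bool :=
  [&& 0 < d, 1 < size pat, all (fun t => all (fun k => entry t k <= d) (iota 0 3)) pat,
      all (fun r => let a := pattern_at pat r in let b := pattern_at pat r.+1 in
                    color_ok d a b (pattern_at pat r.+2) && linked a b) (iota 0 (size pat))
    & has (fun r => tight d (pattern_at pat r) (pattern_at pat r.+1) (pattern_at pat r.+2))
          (iota 0 (size pat))].

Lemma color_okP d a b c k :
  color_ok d a b c -> k < 3 -> 0 < entry b k -> d <= other_total a b c k.
Proof.
rewrite /color_ok /need /other_total /entry /others /=.
move=> ok_abc; case: k => [|[|[|//]]] _ /= bk; move: ok_abc bk.
- by case: (b.1.1) => //= ?; lia.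
- by case: (b.1.2) => //= ?; lia.
- by case: (b.2) => //= ?; lia.
Qed.

Lemma entry_others t (k : 'I_3) : entry (others t) k = \sum_(c < 3 | c != k) entry t c.
Proof.
rewrite big_mkcond !big_ord_recl big_ord0 /entry /others /=.
by case: k => -[|[|[|]]] //= ?; lia.
Qed.

Lemma sum_near (L i : nat) (F : nat -> nat) : i.+2 < L ->
  \sum_(j < L) (if (j <= i.+2) && (i.+1 <= j.+1) then F j else 0) = F i + F i.+1 + F i.+2.
Proof.
move=> lt_iL; pose H j := if (j <= i.+2) && (i.+1 <= j.+1) then F j else 0.
rewrite -(big_mkord xpredT H) (@big_cat_nat _ _ _ i) //=; last by lia.
rewrite big1_seq ?add0n; last by move=> j; rewrite mem_index_iota /H; case: ifP => //; lia.
rewrite big_ltn; last by lia.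
rewrite big_ltn; last by lia.
rewrite big_ltn; last by lia.
rewrite big1_seq; last by move=> j; rewrite mem_index_iota /H; case: ifP => //; lia.
have HE j : i <= j <= i.+2 -> H j = F j by rewrite /H; case: ifP => //; lia.
by rewrite !HE; lia.
Qed.

Section Clump.

Variables (d L : nat) (cnt : nat -> triple).
Hypothesis cnt_le : forall i k, i < L -> k < 3 -> entry (cnt i) k <= d.

(** A vertex is a layer, a colour and a rank within its colour class. Ranks below [d] suffice
    because no class exceeds [d]. *)
Definition block : {pred 'I_L * 'I_3 * 'I_d} :=
  [pred v : 'I_L * 'I_3 * 'I_d | v.2 < entry (cnt v.1.1) v.1.2].

Definition clump_vertex : finType := {v : 'I_L * 'I_3 * 'I_d | v \in block}.

Definition layer_of (v : clump_vertex) : 'I_L := (val v).1.1.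
Definition color_of (v : clump_vertex) : 'I_3 := (val v).1.2.

Definition clump_adj : rel clump_vertex := fun u v =>
  [&& layer_of v <= (layer_of u).+1, layer_of u <= (layer_of v).+1 & color_of v != color_of u].

Lemma clump_adj_sym : symmetric clump_adj.
Proof. by move=> u v; rewrite /clump_adj andbCA eq_sym. Qed.

Lemma clump_adj_irrefl : irreflexive clump_adj.
Proof. by move=> u; rewrite /clump_adj eqxx !andbF. Qed.

Definition clump : sgraph := SGraph clump_adj_sym clump_adj_irrefl.

Lemma clump_vertex_ex i k : i < L -> k < 3 -> 0 < entry (cnt i) k ->
  exists v : clump, layer_of v = i :> nat /\ color_of v = k :> nat.
Proof.
move=> lt_i lt_k cnt_gt0.
have d_gt0 : 0 < d by apply: leq_trans cnt_gt0 (cnt_le _ _).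
have v_block : (Ordinal lt_i, Ordinal lt_k, Ordinal d_gt0) \in block by [].
by exists (exist (fun v => v \in block) _ v_block).
Qed.

Lemma clump_vertex_count (v : clump) : 0 < entry (cnt (layer_of v)) (color_of v).
Proof. by case: v => -[[i k] j] /= v_block; apply: leq_ltn_trans v_block. Qed.

(** Counts by layer and colour; both the order and the degrees are instances. *)
Lemma card_clump_pred (Q : 'I_L -> pred 'I_3) :
  #|[set v : clump | Q (layer_of v) (color_of v)]| =
    \sum_(i < L) \sum_(k < 3 | Q i k) entry (cnt i) k.
Proof.
rewrite -sum1dep_card.
have := @big_sub_cond _ _ addn _ block [pred v | Q v.1.1 v.1.2] (fun=> 1).
move=> /= <-.
transitivity (\sum_(i < L) \sum_(k < 3 | Q i k) \sum_(j < d | j < entry (cnt i) k) 1).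
  rewrite pair_big_dep /= pair_big_dep /=.
  by apply: eq_bigl => -[[i k] j] /=; rewrite andbC.
apply: eq_bigr => i _; apply: eq_bigr => k _.
rewrite -(big_ord_widen _ (fun=> 1)) ?cnt_le //.
by rewrite sum_nat_const card_ord muln1.
Qed.

Lemma card_clump : #|clump| = \sum_(i < L) layer_size (cnt i).
Proof.
have := card_clump_pred (fun _ _ => true); rewrite cardsE => ->.
apply: eq_bigr => i _; rewrite !big_ord_recl big_ord0 /layer_size /entry /=; lia.
Qed.

Lemma clump_degree (v : clump) :
  degree v = \sum_(j < L) (if (j <= (layer_of v).+1) && (layer_of v <= j.+1)
                           then entry (others (cnt j)) (color_of v) else 0).
Proof.
have := card_clump_pred (fun j k => [&& j <= (layer_of v).+1, layer_of v <= j.+1 & k != color_of v]).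
rewrite /degree => ->; apply: eq_bigr => j _; rewrite entry_others.
case: ifP => [/andP[-> ->] //|near].
by rewrite big_pred0 // => k; rewrite andbA near.
Qed.

Lemma clump_degree_inner (v : clump) i : layer_of v = i.+1 :> nat -> i.+2 < L ->
  degree v = other_total (cnt i) (cnt i.+1) (cnt i.+2) (color_of v).
Proof.
move=> lay_v lt_i; rewrite clump_degree lay_v.
exact: (@sum_near L i (fun j => entry (others (cnt j)) (color_of v))).
Qed.

Lemma clump_degree_ge (v : clump) : entry (others (cnt (layer_of v))) (color_of v) <= degree v.
Proof. by rewrite clump_degree (bigD1 (layer_of v)) //= !leqnSn /= leq_addr. Qed.

Lemma clump_colorable : colorable clump 3.
Proof.
apply/existsP; exists [ffun v : clump => color_of v]; apply/forallP => u; apply/forallP => v.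
by rewrite !ffunE eq_sym; apply/implyP => /and3P[].
Qed.

Lemma lay_adj (u v : clump) : adj u v -> layer_of v <= (layer_of u).+1.
Proof. by case/and3P. Qed.

Hypothesis cnt0 : forall k, k < 3 -> 0 < entry (cnt 0) k.
Hypothesis L_gt0 : 0 < L.
Hypothesis cnt_linked : forall i, i.+1 < L -> linked (cnt i) (cnt i.+1).

(** Take linked [v] and [w] of different colours in layers [i] and [i.+1]. If [u] has another colour
    than [v], they are adjacent; otherwise [u] is adjacent to [w], and [w] to [v]. *)
Lemma clump_down (u : clump) i : layer_of u = i.+1 :> nat ->
  exists2 v : clump, layer_of v = i :> nat & connect (@adj clump) u v.
Proof.
move=> lay_u; have lt_i : i.+1 < L by rewrite -lay_u.
have /hasP[k k3 /hasP[k' k'3 /and3P[neq_k cnt_k cnt_k']]] := cnt_linked lt_i.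
rewrite !mem_iota /= !add0n in k3 k'3.
have [v [lay_v col_v]] := clump_vertex_ex (ltnW lt_i) k3 cnt_k.
have [w [lay_w col_w]] := clump_vertex_ex lt_i k'3 cnt_k'.
exists v => //; have [col_uv|col_uv] := eqVneq (color_of u) (color_of v); last first.
  apply: connect1; rewrite /= /clump_adj lay_u lay_v eq_sym col_uv; lia.
apply: (@connect_trans _ _ w); apply: connect1; rewrite /= /clump_adj -!val_eqE /= ?col_uv;
  rewrite ?lay_u ?lay_v ?lay_w ?col_v ?col_w; lia.
Qed.

Lemma clump_connected : connected clump.
Proof.
have [r [lay_r col_r]] := clump_vertex_ex L_gt0 (isT : 0 < 3) (cnt0 (isT : 0 < 3)).
apply/andP; split; first by apply/card_gt0P; exists r.
have [s [lay_s col_s]] := clump_vertex_ex L_gt0 (isT : 1 < 3) (cnt0 (isT : 1 < 3)).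
have sym_connect : connect_sym (@adj clump) by apply/sym_connect_sym/adj_sym.
have rs : connect (@adj clump) s r.
  by apply: connect1; rewrite /= /clump_adj lay_r lay_s -val_eqE /= col_r col_s.
suff to_r u : connect (@adj clump) u r.
  apply/forallP => u; apply/forallP => v.
  by apply: connect_trans (to_r u) _; rewrite sym_connect to_r.
(* Descend to layer 0, where a vertex sharing the colour of [r] reaches it through [s]. *)
move: {2}(nat_of_ord (layer_of u)) (erefl (nat_of_ord (layer_of u))) => n.
elim: n u => [|n IHn] u lay_u; last first.
  by have [v /IHn v_r uv] := clump_down lay_u; apply: connect_trans uv v_r.
have [col_u|col_u] := eqVneq (color_of u) (color_of r).
  apply: connect_trans rs; apply: connect1.
  by rewrite /= /clump_adj lay_u lay_s col_u -val_eqE /= col_r col_s.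
by apply: connect1; rewrite /= /clump_adj lay_u lay_r eq_sym.
Qed.

End Clump.

Lemma min_degree_eq (G : sgraph) (d : nat) (x : G) :
  (forall y : G, d <= degree y) -> degree x = d -> min_degree G = d.
Proof.
move=> deg_ge deg_x; apply/eqP; rewrite eqn_leq -{1}deg_x min_degree_le /=.
rewrite /min_degree; elim/big_ind: _ => [|a b da db|y _]; last exact: deg_ge.
  by rewrite -deg_x max_card.
by rewrite leq_min da.
Qed.

Section Pattern.

Variables (d : nat) (pat : seq triple).
Hypothesis pat_ok : pattern_ok d pat.

Let p := size pat.

Let d_gt0 : 0 < d. Proof. by case/and5P: pat_ok. Qed.
Let p_gt1 : 1 < p. Proof. by case/and5P: pat_ok. Qed.

Definition period_size : nat := sumn [seq layer_size t | t <- pat].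

Lemma pattern_atD i j : pattern_at pat (i + j) = pattern_at pat (i %% p + j).
Proof. by rewrite /pattern_at -/p modnDml. Qed.

Lemma pattern_at_le i k : k < 3 -> entry (pattern_at pat i) k <= d.
Proof.
move=> k3; have /and5P[_ _ /allP le_d _ _] := pat_ok.
have /le_d/allP-> // : pattern_at pat i \in pat.
  by rewrite mem_nth // ltn_mod ltnW.
by rewrite mem_iota.
Qed.

Lemma pattern_at_ok i :
  color_ok d (pattern_at pat i) (pattern_at pat i.+1) (pattern_at pat i.+2)
  && linked (pattern_at pat i) (pattern_at pat i.+1).
Proof.
have /and5P[_ _ _ /allP ok _] := pat_ok.
rewrite -[i]addn0 -addnS -addnS (pattern_atD i 0) (pattern_atD i 1) (pattern_atD i 2).
by rewrite addn0 addn1 addn2; apply: ok; rewrite mem_iota add0n -/p ltn_mod /= ltnW.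
Qed.

Lemma sum_pattern_at m : \sum_(i < p * m) layer_size (pattern_at pat i) = period_size * m.
Proof.
elim: m => [|m IHm]; first by rewrite !muln0 big_ord0.
rewrite !mulnSr big_split_ord /= IHm; congr (_ + _).
rewrite /period_size sumnE big_map (big_nth (0, 0, 0)) big_mkord.
apply: eq_bigr => i _; rewrite /pattern_at -/p mulnC modnMDl modn_small //.
Qed.

(* Four periods leave room for a tight window away from the padded ends. *)
Variable m : nat.
Hypothesis m_ge4 : 4 <= m.

Let n := p * m.

(** A vertex of a full end layer already has [2 * d] neighbours in that layer, and padding never
    shrinks a class, so inner degrees do not drop. *)
Definition padded_layer i : triple :=
  if (i == 0) || (i == n) then (d, d, d) else pattern_at pat i.

Lemma entry_full k : k < 3 -> entry (d, d, d) k = d.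
Proof. by case: k => [|[|[|]]]. Qed.

Lemma padded_layer_le i k : k < 3 -> entry (padded_layer i) k <= d.
Proof.
by move=> k3; rewrite /padded_layer; case: ifP; rewrite ?entry_full ?pattern_at_le.
Qed.

Lemma padded_layer_ge i k : k < 3 -> entry (pattern_at pat i) k <= entry (padded_layer i) k.
Proof.
by move=> k3; rewrite /padded_layer; case: ifP; rewrite ?entry_full ?pattern_at_le.
Qed.

Lemma padded_layer_linked i : linked (padded_layer i) (padded_layer i.+1).
Proof.
have /andP[_ /hasP[k k3 /hasP[k' k'3 /and3P[neq_k ki k'i]]]] := pattern_at_ok i.
apply/hasP; exists k => //; apply/hasP; exists k' => //; rewrite neq_k /=.
rewrite !mem_iota /= !add0n in k3 k'3.
have := padded_layer_ge i k3; have := padded_layer_ge i.+1 k'3; lia.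
Qed.

Definition pattern_graph : sgraph := clump d n.+1 padded_layer.

Let cnt_le i k : i < n.+1 -> k < 3 -> entry (padded_layer i) k <= d.
Proof. by move=> _; apply: padded_layer_le. Qed.

Lemma pattern_graph_connected : connected pattern_graph.
Proof.
apply: clump_connected => //; first by move=> k k3; rewrite /padded_layer eqxx entry_full.
by move=> i _; apply: padded_layer_linked.
Qed.

Lemma other_total_padded i k : k < 3 ->
  other_total (pattern_at pat i) (pattern_at pat i.+1) (pattern_at pat i.+2) k
    <= other_total (padded_layer i) (padded_layer i.+1) (padded_layer i.+2) k.
Proof.
have others_le j k' : k' < 3 ->
    entry (others (pattern_at pat j)) k' <= entry (others (padded_layer j)) k'.
  move=> k'3; rewrite (entry_others _ (Ordinal k'3)) (entry_others _ (Ordinal k'3)).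
  by apply: leq_sum => c _; apply: padded_layer_ge.
by move=> k3; rewrite /other_total !leq_add ?others_le.
Qed.

Lemma pattern_graph_degree_ge (v : pattern_graph) : d <= degree v.
Proof.
have deg_full : padded_layer (layer_of v) = (d, d, d) -> d <= degree v.
  move=> full; apply: leq_trans (clump_degree_ge cnt_le v); rewrite full.
  by case: (color_of v) => -[|[|[|]]] //= _; apply: leq_addr.
have [lay0|lay_neq0] := eqVneq (layer_of v : nat) 0.
  by apply: deg_full; rewrite /padded_layer lay0.
have [layn|lay_neqn] := eqVneq (layer_of v : nat) n.
  by apply: deg_full; rewrite /padded_layer layn eqxx orbT.
have lay_v : layer_of v = (layer_of v).-1.+1 :> nat by lia.
have lt_lay : (layer_of v).-1.+2 < n.+1 by have := ltn_ord (layer_of v); lia.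
rewrite (clump_degree_inner cnt_le lay_v lt_lay).
apply: leq_trans (other_total_padded _ (ltn_ord _)).
have /andP[ok _] := pattern_at_ok (layer_of v).-1.
apply: color_okP ok _ _ => //; rewrite -lay_v.
have := clump_vertex_count v; rewrite /padded_layer.
by rewrite (negbTE lay_neq0) (negbTE lay_neqn).
Qed.

Lemma pattern_graph_min_degree : min_degree pattern_graph = d.
Proof.
have /and5P[_ _ _ _ /hasP[r]] := pat_ok; rewrite mem_iota add0n -/p => /= lt_r.
case/hasP=> k; rewrite mem_iota add0n => /= k3 /andP[k_gt0 /eqP deg_d].
have n_big : 4 * p <= n by rewrite /n mulnC leq_mul2l m_ge4 orbT.
(* The tight window is moved one period in, where it meets neither layer 0 nor layer [n]. *)
have shift j : j <= 2 -> padded_layer (p + (r + j)) = pattern_at pat (r + j).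
  move=> j2; rewrite /padded_layer /pattern_at -/p modnDl.
  by case: ifP => //; lia.
have lt_i : p + (r + 1) < n.+1 by lia.
have [|v [lay_v col_v]] := @clump_vertex_ex d n.+1 padded_layer cnt_le (p + (r + 1)) k lt_i k3.
  by rewrite shift // addn1.
apply: (min_degree_eq (x := v)); first exact: pattern_graph_degree_ge.
have lay_v' : layer_of v = (p + r).+1 :> nat by lia.
have lt_r2 : (p + r).+2 < n.+1 by lia.
rewrite (clump_degree_inner cnt_le lay_v' lt_r2) col_v -deg_d.
have := shift 0 isT; have := shift 1 isT; have := shift 2 isT.
by rewrite !addnS !addn0 => -> -> ->.
Qed.

(** The full layers 0 and [n] have [3 * d] vertices each, and the first replaces one pattern layer.
    That layer is added on the left to avoid truncated subtraction. *)
Lemma card_pattern_graph :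
  #|pattern_graph| + layer_size (pattern_at pat 0) = period_size * m + 6 * d.
Proof.
rewrite card_clump // -sum_pattern_at -/n big_ord_recr /=.
have -> : layer_size (padded_layer n) = 3 * d by rewrite /padded_layer eqxx orbT /layer_size /=; lia.
have n_gt0 : 0 < n by rewrite muln_gt0; lia.
have inner : \sum_(i < n | i != Ordinal n_gt0) layer_size (padded_layer i)
    = \sum_(i < n | i != Ordinal n_gt0) layer_size (pattern_at pat i).
  apply: eq_bigr => i; rewrite -val_eqE /= /padded_layer => i_neq0.
  by case: ifP => //; have := ltn_ord i; lia.
rewrite (bigD1 (Ordinal n_gt0)) //= [in RHS](bigD1 (Ordinal n_gt0)) //= inner.
have -> : layer_size (padded_layer 0) = 3 * d by rewrite /padded_layer eqxx /layer_size /=; lia.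
by move: (layer_size _) (\sum_(_ < n | _) _) => a b; lia.
Qed.

Lemma pattern_graph_diam : n <= diam pattern_graph.
Proof.
have lay_ex i : (i == 0) || (i == n) -> i < n.+1 -> exists v : pattern_graph, layer_of v = i :> nat.
  move=> i_end lt_i.
  have [|v [lay_v _]] := @clump_vertex_ex d n.+1 padded_layer cnt_le i 0 lt_i isT.
    by rewrite /padded_layer i_end.
  by exists v.
have [x lay_x] := lay_ex 0 isT (ltn0Sn _).
have [y lay_y] : exists y : pattern_graph, layer_of y = n :> nat by apply: lay_ex; rewrite ?eqxx ?orbT.
apply: leq_trans (dist_le_diam x y).
have := @dist_ge pattern_graph (fun v => layer_of v) x y.
by rewrite lay_x lay_y; apply; [move=> u v; apply: lay_adj | apply: pattern_graph_connected].
Qed.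

End Pattern.

Local Open Scope ring_scope.

(** * Exact slopes from matching bounds *)

Lemma diam_boundI (P : sgraph -> Prop) (d D N : nat) : (0 < N)%N ->
  (exists K, forall G : sgraph, connected G -> min_degree G = d -> P G ->
     (N * diam G <= D * #|G| + K)%N) ->
  diam_bound P d (D%:R / N%:R).
Proof.
move=> N_gt0 [K leK]; exists (K%:R / N%:R) => G conG deg_G PG.
rewrite mulrAC -mulrDl ler_pdivlMr ?ltr0n // -!natrM -natrD ler_nat mulnC.
exact: leK.
Qed.

(** Over [m] periods the order is [w * m] plus a constant and the diameter is at least [p * m], so
    [q * w < p] fails for large [m]. *)
Lemma diam_bound_slope (P : sgraph -> Prop) (d : nat) (pat : seq triple) (q : rat) :
  pattern_ok d pat -> (0 < period_size pat)%N ->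
  (forall G, colorable G 3 -> P G) -> diam_bound P d q ->
  (size pat)%:R / (period_size pat)%:R <= q.
Proof.
move=> pat_ok w_gt0 PG [C leC]; set p := (size pat)%:R; set w := (period_size pat)%:R.
rewrite ler_pdivrMr ?ltr0n //; rewrite leNgt; apply/negP => lt_q.
(* [B] collects the constants, so that the assumed bound reads [e * m <= B]; the choice of [m]
   contradicts it. *)
pose B := q * (6 * d)%:R - q * (layer_size (pattern_at pat 0))%:R + C.
pose e := p - q * w; have e_gt0 : 0 < e by rewrite subr_gt0.
pose m := maxn 4 (Num.bound (`|B| / e)).
have m4 : (4 <= m)%N by apply: leq_maxl.
have := leC _ (pattern_graph_connected pat_ok m4) (pattern_graph_min_degree pat_ok m4)
  (PG _ (clump_colorable _ _ _)).
have cardE : #|pattern_graph d pat m|%:R + (layer_size (pattern_at pat 0))%:R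
    = w * m%:R + (6 * d)%:R :> rat.
  by rewrite -natrM -!natrD card_pattern_graph.
have : p * m%:R <= (diam (pattern_graph d pat m))%:R.
  by rewrite -natrM ler_nat pattern_graph_diam.
have : `|B| / e < m%:R.
  apply: lt_le_trans (archi_boundP _) _; first by rewrite divr_ge0 // ltW.
  by rewrite ler_nat leq_maxr.
rewrite ltr_pdivrMr // => lt_B le_diam diam_le.
have := ler_norm B; suff: e * m%:R <= B by lra.
suff -> : B = q * #|pattern_graph d pat m|%:R + C - q * w * m%:R by rewrite /e; lra.
have -> : #|pattern_graph d pat m|%:R = w * m%:R + (6 * d)%:R
    - (layer_size (pattern_at pat 0))%:R :> rat by rewrite -cardE addrK.
by rewrite /B; ring.
Qed.

Lemma smallest_slopeI (P : sgraph -> Prop) (d D N : nat) (pat : seq triple) :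
  (0 < N)%N -> (forall G, colorable G 3 -> P G) ->
  (exists K, forall G : sgraph, connected G -> min_degree G = d -> P G ->
     (N * diam G <= D * #|G| + K)%N) ->
  pattern_ok d pat -> (0 < period_size pat)%N -> (D * period_size pat = size pat * N)%N ->
  smallest_slope P d (D%:R / N%:R).
Proof.
move=> N_gt0 PG upper pat_ok w_gt0 slope; split; first exact: diam_boundI.
move=> q /(diam_bound_slope pat_ok w_gt0 PG); suff -> : D%:R / N%:R =
  (size pat)%:R / (period_size pat)%:R :> rat by [].
by apply/eqP; rewrite eqr_div ?pnatr_eq0 -?lt0n // -!natrM slope.
Qed.

Lemma colorable_chromatic_number (G : sgraph) (k : nat) :
  colorable G k -> (chromatic_number G <= k)%N.
Proof. by move=> col_k; rewrite /chromatic_number; case: ex_minnP => n _; apply. Qed.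

Lemma chromatic_clique_number (G : sgraph) : (clique_number G <= chromatic_number G)%N.
Proof.
by apply: colorable_clique_number; rewrite /chromatic_number; case: ex_minnP.
Qed.

(** One upper bound and one pattern settle both classes: 3-colourable graphs have clique number at
    most 3, and the pattern graphs are 3-colourable. *)
Lemma size_check_slopes (d M D N k : nat) (pat : seq triple) :
  (0 < M)%N -> (0 < N)%N -> size_check d M D N k ->
  pattern_ok d pat -> (0 < period_size pat)%N -> (D * period_size pat = size pat * N)%N ->
  f_is d (D%:R / N%:R) /\ f'_is d (D%:R / N%:R).
Proof.
move=> M_gt0 N_gt0 /(K4free_diam_bound M_gt0)[K leK] pat_ok w_gt0 slope.
split; apply: (@smallest_slopeI _ d D N pat) => //.
- by move=> G; apply: colorable_clique_number.
- by exists K.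
- by move=> G; apply: colorable_chromatic_number.
- exists K => G conG deg_G chi3; apply: leK => //.
  exact: leq_trans (chromatic_clique_number G) chi3.
Qed.

(* Tight cycles of the colour automaton, found by computer search. *)
Definition pattern4 : seq triple := [:: (1, 1, 0); (0, 0, 2); (1, 1, 0); (0, 0, 1)]%N.

Definition pattern5 : seq triple :=
  [:: (0, 1, 0); (2, 0, 2); (0, 2, 0); (0, 0, 1); (1, 2, 0);
      (1, 0, 2); (0, 1, 0); (0, 0, 2); (2, 2, 0); (0, 0, 1)]%N.

Definition pattern6 : seq triple :=
  [:: (0, 2, 0); (2, 0, 3); (0, 2, 0); (0, 0, 1); (2, 2, 0); (0, 0, 3); (1, 1, 0);
      (0, 0, 2); (2, 2, 0); (0, 0, 2); (1, 1, 0); (0, 0, 3); (2, 2, 0); (0, 0, 1)]%N.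

Definition pattern7 : seq triple :=
  [:: (0, 1, 0); (3, 0, 3); (0, 3, 0); (0, 0, 1); (1, 3, 0); (2, 0, 3);
      (0, 1, 0); (0, 0, 2); (3, 3, 0); (0, 0, 2); (0, 1, 0); (3, 0, 2);
      (0, 3, 1); (1, 0, 0); (0, 0, 3); (3, 3, 0); (0, 0, 1)]%N.

Definition pattern8 : seq triple := [:: (2, 2, 0); (0, 0, 3)]%N.

(** * Certificates by computation, and the values *)

Lemma size_check4 : size_check 4 4 4 7 3.
Proof. by vm_compute. Qed.

Lemma size_check5 : size_check 5 6 5 11 9.
Proof. by vm_compute. Qed.

Lemma size_check6 : size_check 6 8 14 37 14.
Proof. by vm_compute. Qed.

Lemma size_check8 : size_check 8 11 2 7 16.
Proof. by vm_compute. Qed.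

Lemma color_check7 : color_check 7 7 17 52 18.
Proof. by vm_compute. Qed.

Theorem mainTheorem7 :
  [/\ f_is 4 (4 / 7) /\ f'_is 4 (4 / 7),
      f_is 5 (5 / 11) /\ f'_is 5 (5 / 11),
      f_is 6 (14 / 37) /\ f'_is 6 (14 / 37),
      f'_is 7 (17 / 52)
    & f'_is 8 (2 / 7)].
Proof.
split.
- exact: (size_check_slopes (pat := pattern4) _ _ size_check4).
- exact: (size_check_slopes (pat := pattern5) _ _ size_check5).
- exact: (size_check_slopes (pat := pattern6) _ _ size_check6).
- apply: (@smallest_slopeI _ 7 17 52 pattern7) => //.
    by move=> G; apply: colorable_chromatic_number.
  exact: (@color_diam_bound 7 7 17 52 18 isT color_check7).
- by have [] := size_check_slopes (pat := pattern8) _ _ size_check8.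
Qed.
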